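(* Let $T$ be an uncountable set, let $\{B_t : t\in T\}$ be a collection of Banach spaces, and let $X$ be a complemented subspace of the locally convex direct sum $\bigoplus\{B_t : t\in T\}$. Then there exist a set $J$ and, for each $j\in J$, a subset $T_j\subseteq T$ with $|T_j|=\omega$ (i.e. $T_j$ is countably infinite) and a complemented subspace $F_j$ of the countable locally convex direct sum $\bigoplus\{B_t : t\in T_j\}$, such that $X$ is isomorphic to the locally convex direct sum $\bigoplus\{F_j : j\in J\}$.
   Context: All vector spaces are over a fixed scalar field ($\mathbb{R}$ or $\mathbb{C}$). For a family $\{E_t : t\in T\}$ of locally convex spaces, the locally convex direct sum $\bigoplus\{E_t : t\in T\}$ is the algebraic direct sum (families $\{x_t\}_{t\in T}$ with $x_t\in E_t$ and $x_t=0$ for all but finitely many $t$) equipped with the finest locally convex topology making all canonical inclusions $E_t\to\bigoplus\{E_t : t\in T\}$ continuous. A linear subspace $X$ of a locally convex space $E$, with the subspace topology, is complemented if there is a continuous linear map $r\colon E\to X$ with $r(x)=x$ for all $x\in X$. ''Isomorphic'' means isomorphic as topological vector spaces, i.e. via a linear homeomorphism. *)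

(* Defs.v *)
From HB Require Import structures.
From mathcomp Require Import all_boot all_order all_algebra.
From mathcomp Require Import complex.
From mathcomp Require Import finmap.
From mathcomp Require Import all_classical all_reals all_analysis.

Set Implicit Arguments.
Unset Strict Implicit.
Unset Printing Implicit Defensive.

Import Order.TTheory GRing.Theory Num.Theory.
Import numFieldTopology.Exports numFieldNormedType.Exports.
Import complex.

Local Open Scope classical_set_scope.
Local Open Scope ring_scope.

Variant real_or_complex : numFieldType -> Prop :=
| RealScalars (R : realType) : real_or_complex R
| ComplexScalars (R : realType) : real_or_complex R[i].

(* The three conditions are the fields of [PreTopologicalLmod_isTvs], for a
   topology [tau] that need not be the canonical one of [M]. *)
Definition locally_convex_topology (K : numFieldType) (M : lmodType K)
    (tau : Topological M) : Prop :=
  let X := Topological.Pack tau in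
  [/\ continuous ((fun z => (z.1 : M) + (z.2 : M)) : X * X -> X),
      continuous ((fun z => (z.1 : K) *: (z.2 : M)) : K^o * X -> X) &
      exists2 B : set_system X,
        (forall b, b \in B -> @convex_set K M b) & basis B].

(* Like [sup_topology], for a class [P] of topologies on [T] rather than an
   indexed family. *)
Definition join_topology (T : Type) (P : Topological T -> Prop) : Type := T.

Section join_topology.
Variables (T : choiceType) (P : Topological T -> Prop).
Local Notation S := (join_topology P).

Definition join_subbase : set_system T :=
  [set U : set T | exists2 tau, P tau & @open (Topological.Pack tau) U].

HB.instance Definition _ := Choice.on S.
HB.instance Definition _ := isSubBaseTopological.Build S join_subbase id.

Lemma join_cvg (F : set_system T) (t : T) : Filter F ->
  (forall tau, P tau -> F --> (t : Topological.Pack tau)) -> F --> (t : S).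
Proof.
move=> FF Ft A; rewrite nbhsE => -[_ [[D sD <-] [C DC Ct]] DA].
rewrite nbhs_filterE; apply: filterS DA _; apply: (@filterS _ _ _ C).
  by move=> ? ?; exists C.
have [B sB BC] := sD _ DC; rewrite -BC; apply: filter_bigI => U UB.
have := sB _ UB; rewrite inE => -[tau Ptau oU].
apply: (Ft _ Ptau); apply: open_nbhs_nbhs; split=> //.
by move: Ct; rewrite -BC; exact.
Qed.

Lemma join_open tau : P tau ->
  (@open (Topological.Pack tau) : set_system T) `<=` (@open S : set_system T).
Proof.
move=> Ptau U oU; exists [set U]; last by rewrite bigcup_set1.
move=> _ ->; exists [fset U]%fset.
  by move=> V /fset1P ->; rewrite inE; exists tau.
by rewrite set_fset1 bigcap_set1.
Qed.

Lemma join_id_continuous tau : P tau ->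
  continuous (id : S -> Topological.Pack tau).
Proof. by move=> Ptau; apply/continuousP => U /(join_open Ptau). Qed.

End join_topology.

Section join_tvs.
Variables (K : numFieldType) (M : lmodType K) (P : Topological M -> Prop).
Hypothesis PP : forall tau, P tau -> locally_convex_topology tau.
Let S := join_topology P.
Let X (tau : Topological M) : topologicalType := Topological.Pack tau.

Lemma join_add_continuous :
  continuous ((fun z => (z.1 : M) + (z.2 : M)) : S * S -> S).
Proof.
move=> z; apply: join_cvg => i Ptau.
have [addc _ _] := PP Ptau.
apply: (@cvg_comp _ _ _ (fun z : S * S => ((z.1, z.2) : X i * X i))
  (fun z : X i * X i => (z.1 : M) + (z.2 : M) : X i)); last exact: addc.
apply: cvg_pair.
  apply: (@cvg_comp _ _ _ (fst : S * S -> S) (id : S -> X i)).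
    exact: cvg_fst.
  exact: (join_id_continuous Ptau).
apply: (@cvg_comp _ _ _ (snd : S * S -> S) (id : S -> X i)).
  exact: cvg_snd.
exact: (join_id_continuous Ptau).
Qed.

Lemma join_scale_continuous :
  continuous ((fun z => (z.1 : K) *: (z.2 : M)) : K^o * S -> S).
Proof.
move=> z; apply: join_cvg => i Ptau.
have [_ scalec _] := PP Ptau.
apply: (@cvg_comp _ _ _ (fun z : K^o * S => ((z.1, z.2) : K^o * X i))
  (fun z : K^o * X i => (z.1 : K) *: (z.2 : M) : X i)); last exact: scalec.
apply: (@cvg_pair _ _ _ _ (nbhs (z.1 : K^o)) (nbhs (z.2 : X i))).
  exact: cvg_fst.
apply: (@cvg_comp _ _ _ (snd : K^o * S -> S) (id : S -> X i)).
  exact: cvg_snd.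
exact: (join_id_continuous Ptau).
Qed.

Lemma join_locally_convex : exists2 B : set_system S,
  (forall b, b \in B -> @convex_set K M b) & basis B.
Proof.
exists [set b : set S | open b /\ @convex_set K M b].
  by move=> b /[!inE] -[].
split=> [b []//|x A]; rewrite nbhsE => -[_ [[D sD <-] [C DC Cx]] DA].
have [F sF FC] := sD _ DC.
have Fx (V : set S) : V \in F -> V x by move=> VF; move: Cx; rewrite -FC; exact.
have FA : \bigcap_(V in [set` F]) V `<=` A.
  by rewrite FC; apply: subset_trans DA => y Cy; exists C.
pose good (V b : set S) := [/\ open b, @convex_set K M b, b x & b `<=` V].
have ex_good (V : set S) : exists b, V \in F -> good V b.
  have [VF|] := boolP (V \in F); last by exists V.
  have := sF _ VF; rewrite inE => -[i Ptau oV].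
  have [_ _ [B Bconv [Bopen Bbase]]] := PP Ptau.
  have [|b [Bb bx] bV] := Bbase x V; first exact: open_nbhs_nbhs (conj oV (Fx _ VF)).
  exists b => _; split=> //; last by apply: Bconv; rewrite inE.
  exact: (join_open Ptau (Bopen _ Bb)).
have [g gP] := choice ex_good.
exists (\bigcap_(V in [set` F]) g V).
  split; last by move=> V /= VF; have [] := gP _ VF.
  split.
    rewrite bigcap_fset big_seq; elim/big_ind: _ => [|U V oU oV|V VF].
    - exact: openT.
    - exact: openI.
    - by have [] := gP _ VF.
  move=> y z l /set_mem yg /set_mem zg; apply/mem_set => V VF.
  have [_ gconv _ _] := gP _ VF.
  by apply/set_mem/gconv; apply/mem_set; [exact: yg|exact: zg].
by apply: subset_trans FA => y gy V VF; have [_ _ _] := gP _ VF; apply; exact: gy.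
Qed.

End join_tvs.

Section product.
Variables (K : numFieldType) (I : Type) (E : I -> lmodType K).

Definition dprod := forall i, E i.

HB.instance Definition _ := gen_eqMixin dprod.
HB.instance Definition _ := gen_choiceMixin dprod.

Let add (f g : dprod) : dprod := fun i => f i + g i.
Let opp (f : dprod) : dprod := fun i => - f i.
Let scale (a : K) (f : dprod) : dprod := fun i => a *: f i.

Let addA : associative add.
Proof. by move=> f g h; apply: functional_extensionality_dep => i; exact: addrA. Qed.
Let addC : commutative add.
Proof. by move=> f g; apply: functional_extensionality_dep => i; exact: addrC. Qed.
Let add0 : left_id (fun i => 0) add.
Proof. by move=> f; apply: functional_extensionality_dep => i; exact: add0r. Qed.
Let addN : left_inverse (fun i => 0) opp add.
Proof. by move=> f; apply: functional_extensionality_dep => i; exact: addNr. Qed.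
HB.instance Definition _ := GRing.isZmodule.Build dprod addA addC add0 addN.

Let scaleA a b f : scale a (scale b f) = scale (a * b) f.
Proof. by apply: functional_extensionality_dep => i; exact: scalerA. Qed.
Let scale1 : left_id 1 scale.
Proof. by move=> f; apply: functional_extensionality_dep => i; exact: scale1r. Qed.
Let scaleDr : right_distributive scale +%R.
Proof. by move=> a f g; apply: functional_extensionality_dep => i; exact: scalerDr. Qed.
Let scaleDl f : {morph scale^~ f : a b / a + b}.
Proof. by move=> a b; apply: functional_extensionality_dep => i; exact: scalerDl. Qed.
HB.instance Definition _ :=
  GRing.Zmodule_isLmodule.Build K dprod scaleA scale1 scaleDr scaleDl.

Definition finite_support : {pred dprod} :=
  fun f => `[< finite_set [set i | f i != 0] >].

Lemma finite_support_submod : submod_closed finite_support.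
Proof.
split=> [|a f g].
  rewrite unfold_in; apply/asboolP.
  by rewrite (_ : mkset _ = set0)// -subset0 => i /=; rewrite eqxx.
rewrite !unfold_in => /asboolP ff /asboolP gf; apply/asboolP.
apply: (sub_finite_set (B := [set i | f i != 0] `|` [set i | g i != 0])).
  move=> i /= fgi; have [fi0|] := eqVneq (f i) 0; last by left.
  right; apply: contra_neq fgi => gi0.
  by rewrite -[LHS]/(a *: f i + g i) fi0 gi0 scaler0 addr0.
by rewrite finite_setU.
Qed.
HB.instance Definition _ :=
  GRing.isSubmodClosed.Build K dprod finite_support finite_support_submod.

End product.

Section direct_sum.
Variables (K : numFieldType) (I : Type) (E : I -> tvsType K).

Record lcsum := Lcsum {
  lcsum_val :> dprod (fun i => E i : lmodType K);
  _ : lcsum_val \in @finite_support K I (fun i => E i : lmodType K) }.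

HB.instance Definition _ := [isSub for lcsum_val].
HB.instance Definition _ := [Choice of lcsum by <:].
HB.instance Definition _ := [SubChoice_isSubZmodule of lcsum by <:].
HB.instance Definition _ := [SubZmodule_isSubLmodule of lcsum by <:].

Let J := {classic I}.
Let E' (i : J) := E i.

Lemma lcsum_in_subproof (i : I) (x : E i) :
  (@dfwith J E' (fun=> 0) i x : dprod (fun i => E i : lmodType K))
    \in @finite_support K I (fun i => E i : lmodType K).
Proof.
rewrite unfold_in; apply/asboolP; apply: (sub_finite_set (B := [set i])) => //.
move=> j /=; apply: contra_neqP => ji.
by rewrite dfwithout//; apply/eqP => ij; apply: ji.
Qed.

(* The canonical inclusion of [E i]; [{classic I}] provides the decidable
   equality that [dfwith] needs on the index type. *)
Definition lcsum_in (i : I) (x : E i) : lcsum := Lcsum (lcsum_in_subproof x).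

Definition lcsum_admissible (tau : Topological lcsum) : Prop :=
  locally_convex_topology tau /\
  forall i, continuous (@lcsum_in i : E i -> Topological.Pack tau).

(* The supremum of all admissible topologies; it is itself admissible, hence it
   is the finest one: see [lcsum_in_continuous] and [lcsum_finest]. *)
HB.instance Definition _ :=
  Topological.copy lcsum (join_topology lcsum_admissible).

Let add_continuous : continuous (fun z : lcsum * lcsum => z.1 + z.2).
Proof. by apply: join_add_continuous => tau []. Qed.

Let scale_continuous : continuous (fun z : K^o * lcsum => z.1 *: z.2).
Proof. by apply: join_scale_continuous => tau []. Qed.

Let locally_convex : exists2 B : set_system lcsum,
  (forall b, b \in B -> convex_set b) & basis B.
Proof. by apply: join_locally_convex => tau []. Qed.

(* The factory [PreTopologicalLmod_isTvs] only provides the uniformity. *)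
HB.instance Definition _ := PreTopologicalLmod_isTvs.Build K lcsum
  add_continuous scale_continuous locally_convex.
HB.instance Definition _ :=
  PreTopologicalNmodule_isTopologicalNmodule.Build lcsum add_continuous.
HB.instance Definition _ :=
  TopologicalNmodule_isTopologicalLmodule.Build K lcsum scale_continuous.
HB.instance Definition _ := Uniform_isTvs.Build K lcsum locally_convex.

Lemma lcsum_in_continuous i : continuous (@lcsum_in i : E i -> lcsum).
Proof. by move=> x; apply: join_cvg => tau [_ inc]; exact: inc. Qed.

Lemma lcsum_finest (tau : Topological lcsum) : lcsum_admissible tau ->
  continuous (id : lcsum -> Topological.Pack tau).
Proof. exact: join_id_continuous. Qed.

End direct_sum.

Definition lin_subspace (K : numFieldType) (E : tvsType K) : Type :=
  submodClosed E.

(* [lcsub X] is the subspace [X] as a space of its own, with the topology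
   induced by [E]. *)
Section subspace.
Variables (K : numFieldType) (E : tvsType K) (X : lin_subspace E).

Record lcsub := Lcsub { lcsub_val :> E; _ : lcsub_val \in X }.

HB.instance Definition _ := [isSub for lcsub_val].
HB.instance Definition _ := [Choice of lcsub by <:].
HB.instance Definition _ := [SubChoice_isSubLmodule of lcsub by <:].
HB.instance Definition _ := Topological.copy lcsub (initial_topology lcsub_val).

Lemma lcsub_valD (x y : lcsub) : (x + y : lcsub) = (x : E) + (y : E) :> E.
Proof. exact: (raddfD (\val : lcsub -> E)). Qed.

Lemma lcsub_valZ a (x : lcsub) : (a *: x : lcsub) = a *: (x : E) :> E.
Proof. exact: (linearZ_LR (\val : lcsub -> E)). Qed.

Lemma lcsub_val_continuous : continuous (lcsub_val : lcsub -> E).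
Proof. exact: initial_continuous. Qed.

Let add_continuous : continuous (fun z : lcsub * lcsub => z.1 + z.2).
Proof.
apply: (@continuous_comp_initial lcsub (lcsub * lcsub)%type E lcsub_val).
rewrite (_ : _ \o _ = fun z => lcsub_val z.1 + lcsub_val z.2); last first.
  by apply/funext => z; exact: lcsub_valD.
move=> z.
apply: (@cvg_comp (lcsub * lcsub)%type (E * E)%type E
  (fun z => (z.1 : E, z.2 : E)) (fun z => z.1 + z.2)
  (nbhs z) (nbhs (z.1 : E, z.2 : E)) (nbhs ((z.1 : E) + (z.2 : E))));
  last exact: (@add_continuous E (z.1 : E, z.2 : E)).
apply: (@cvg_pair _ _ _ _ (nbhs (z.1 : E)) (nbhs (z.2 : E))).
  apply: (@cvg_comp _ _ _ (fst : lcsub * lcsub -> lcsub) lcsub_val).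
    exact: cvg_fst.
  exact: lcsub_val_continuous.
apply: (@cvg_comp _ _ _ (snd : lcsub * lcsub -> lcsub) lcsub_val).
  exact: cvg_snd.
exact: lcsub_val_continuous.
Qed.

Let scale_continuous : continuous (fun z : K^o * lcsub => z.1 *: z.2).
Proof.
apply: (@continuous_comp_initial lcsub (K^o * lcsub)%type E lcsub_val).
rewrite (_ : _ \o _ = fun z => z.1 *: lcsub_val z.2); last first.
  by apply/funext => z; exact: lcsub_valZ.
move=> z.
apply: (@cvg_comp (K^o * lcsub)%type (K^o * E)%type E
  (fun z => (z.1 : K^o, z.2 : E)) (fun z => z.1 *: z.2)
  (nbhs z) (nbhs (z.1 : K^o, z.2 : E)) (nbhs (z.1 *: (z.2 : E))));
  last exact: (@scale_continuous K E (z.1, z.2 : E)).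
apply: (@cvg_pair _ _ _ _ (nbhs (z.1 : K^o)) (nbhs (z.2 : E))).
  exact: cvg_fst.
apply: (@cvg_comp _ _ _ (snd : K^o * lcsub -> lcsub) lcsub_val).
  exact: cvg_snd.
exact: lcsub_val_continuous.
Qed.

Let locally_convex : exists2 B : set_system lcsub,
  (forall b, b \in B -> convex_set b) & basis B.
Proof.
have [B Bconv [Bopen Bbase]] := @locally_convex K E.
exists [set lcsub_val @^-1` b | b in B].
  move=> _ /[!inE] -[b Bb <-] x y l /set_mem bx /set_mem yb; apply/mem_set.
  have := Bconv b (mem_set Bb) (x : E) (y : E) l (mem_set bx) (mem_set yb).
  pose w := (l%:num *: (x : lcsub) + (1 - l%:num) *: (y : lcsub) : lcsub).
  have wE : lcsub_val w = l%:num *: (x : E) + (1 - l%:num) *: (y : E).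
    by rewrite lcsub_valD !lcsub_valZ.
  by move=> /set_mem bw; suff: b (lcsub_val w) by []; rewrite wE.
split=> [_ [b Bb <-]|x A]; first by exists b => //; exact: Bopen.
rewrite nbhsE => -[_ [[U oU <-] Ux] UA].
have [|b [Bb bx] bU] := Bbase (x : E) U; first exact: open_nbhs_nbhs.
exists (lcsub_val @^-1` b); first by split => //; exists b.
by move=> y by_; apply: UA; exact: bU.
Qed.

HB.instance Definition _ := PreTopologicalLmod_isTvs.Build K lcsub
  add_continuous scale_continuous locally_convex.
HB.instance Definition _ :=
  PreTopologicalNmodule_isTopologicalNmodule.Build lcsub add_continuous.
HB.instance Definition _ :=
  TopologicalNmodule_isTopologicalLmodule.Build K lcsub scale_continuous.
HB.instance Definition _ := Uniform_isTvs.Build K lcsub locally_convex.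

Definition complemented :=
  exists2 r : {linear E -> lcsub}, continuous r &
    forall x : lcsub, r (lcsub_val x) = x.

End subspace.

(* The inverse [g] of the linear map [f] is automatically linear. *)
Definition lc_isomorphic (K : numFieldType) (E F : tvsType K) :=
  exists (f : {linear E -> F}) (g : F -> E),
    [/\ cancel f g, cancel g f, continuous f & continuous g].

(* Main.v *)
Require Import Defs.
From HB Require Import structures.
From mathcomp Require Import all_boot all_order all_algebra.
From mathcomp Require Import complex.
From mathcomp Require Import finmap.
From mathcomp Require wochoice.
From mathcomp Require Import all_classical all_reals all_analysis.

(* Let [r] be a continuous projection of the direct sum [E] of the [B t] onto
   [X]. The image under [r] of a single summand [B t] lies in a finite
   subsum, because a continuous linear map from a normed space into a locally
   convex direct sum has bounded, hence finitely supported, range on balls.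
   Closing each index under these finite supports and well-ordering [T] yields
   a ranking [rho] of [T] with countable fibres for which the matrix of [r] is
   block triangular. The block diagonal [d] of [r] is then idempotent as well,
   and [u = r d + (1 - r) (1 - d)] is [1] minus a strictly triangular map
   which, by well-foundedness and finiteness of the columns, is nilpotent on
   every summand; so [u] is an automorphism, and [r u = r d = u d] shows that it
   maps the range of [d] onto the range [X] of [r]. The range of [d] is the
   direct sum of the ranges of its blocks, which live on the countable fibres
   of [rho]; a fixed countably infinite set of indices is added to every fibre
   to make them infinite. *)

Set Implicit Arguments.
Unset Strict Implicit.
Unset Printing Implicit Defensive.

Import Order.TTheory GRing.Theory Num.Theory numFieldNormedType.Exports.

Local Open Scope classical_set_scope.
Local Open Scope ring_scope.

(** * Locally convex direct sums *)

Lemma continuous_tvsD (K : numDomainType) (X : topologicalType) (V : tvsType K)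
    (f g : X -> V) :
  continuous f -> continuous g -> continuous (fun x => f x + g x).
Proof.
move=> fc gc x.
apply: (@continuous_comp X (V * V)%type V (fun x => (f x, g x))
  (fun z => z.1 + z.2)); last exact: add_continuous.
by apply: cvg_pair; [exact: fc|exact: gc].
Qed.

Lemma continuous_tvsB (K : numDomainType) (X : topologicalType) (V : tvsType K)
    (f g : X -> V) :
  continuous f -> continuous g -> continuous (fun x => f x - g x).
Proof.
move=> fc gc; apply: continuous_tvsD => // x.
by apply: continuous_comp; [exact: gc|exact: opp_continuous].
Qed.

(** Linear preimages of convex sets are convex. This makes the pullback topology of [f] a candidate
    for [lcsum_admissible]. *)
Lemma initial_locally_convex (K : numFieldType) (M : lmodType K)
    (G : tvsType K) (f : {linear M -> G}) :
  @locally_convex_topology K M (Topological.class (initial_topology f)).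
Proof.
pose X : topologicalType := initial_topology f.
have fc : continuous (f : X -> G) by exact: initial_continuous.
split.
- apply: (@continuous_comp_initial X (X * X)%type G f).
  rewrite (_ : _ \o _ = fun z : X * X => f z.1 + f z.2); last first.
    by apply/funext => z /=; rewrite linearD.
  apply: continuous_tvsD => z.
  + by apply: (@continuous_comp _ X); [exact: cvg_fst|exact: fc].
  + by apply: (@continuous_comp _ X); [exact: cvg_snd|exact: fc].
- apply: (@continuous_comp_initial X (K^o * X)%type G f).
  rewrite (_ : _ \o _ = fun z : K^o * X => z.1 *: f z.2); last first.
    by apply/funext => z /=; rewrite linearZ.
  move=> z.
  apply: (@continuous_comp (K^o * X)%type (K^o * G)%type G
    (fun z => (z.1, f z.2)) (fun z => z.1 *: z.2));
    last exact: scale_continuous.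
  apply: (@cvg_pair _ _ _ _ (nbhs (z.1 : K^o))); first exact: cvg_fst.
  by apply: (@continuous_comp _ X); [exact: cvg_snd|exact: fc].
- have [C Cconv [Copen Cbase]] := @locally_convex K G.
  exists [set f @^-1` b | b in C].
    move=> _ /[!inE] -[b Cb <-] x y l /set_mem bx /set_mem yb; apply/mem_set.
    have := Cconv b (mem_set Cb) (f x) (f y) l (mem_set bx) (mem_set yb).
    move=> /set_mem bw.
    suff: b (f (l%:num *: x + (1 - l%:num) *: y)) by [].
    by rewrite linearD !linearZ.
  split=> [_ [b Cb <-]|x A]; first by exists b => //; exact: Copen.
  rewrite nbhsE => -[_ [[U oU <-] Ux] UA].
  have [|b [Cb bx] bU] := Cbase (f x) U; first exact: open_nbhs_nbhs.
  exists (f @^-1` b); first by split => //; exists b.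
  by move=> y fy; apply: UA; exact: bU.
Qed.

Section lcsum_theory.
Variables (K : numFieldType) (I : Type) (E : I -> tvsType K).
Implicit Types (i : I) (f g : lcsum E).

Definition lcsum_coord i (f : lcsum E) : E i := lcsum_val f i.

#[global] Arguments lcsum_coord : simpl never.
#[global] Arguments lcsum_in : simpl never.

Lemma lcsum_coord_linear i : linear (lcsum_coord i).
Proof.
move=> a f g; rewrite /lcsum_coord.
by rewrite (_ : lcsum_val (a *: f + g) = a *: lcsum_val f + lcsum_val g).
Qed.
HB.instance Definition _ i := GRing.isLinear.Build K (lcsum E) (E i) _
  (lcsum_coord i) (@lcsum_coord_linear i).

Lemma lcsum_coordZ i a f : lcsum_coord i (a *: f) = a *: lcsum_coord i f.
Proof. exact: linearZ. Qed.

Lemma lcsum_coordB i f g :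
  lcsum_coord i (f - g) = lcsum_coord i f - lcsum_coord i g.
Proof. exact: linearB. Qed.

Lemma lcsumP f g : (forall i, lcsum_coord i f = lcsum_coord i g) -> f = g.
Proof.
move=> fg; apply: val_inj => /=.
exact: (functional_extensionality_dep fg).
Qed.

Lemma lcsum_finite f : finite_set [set i | lcsum_coord i f != 0].
Proof. by rewrite /lcsum_coord; case: f => f /= /asboolP. Qed.

Lemma lcsum_in_id i (x : E i) : lcsum_coord i (lcsum_in x) = x.
Proof. exact: (@dfwith_in {classic I}). Qed.

Lemma lcsum_in_neq i j (x : E i) : i <> j -> lcsum_coord j (lcsum_in x) = 0.
Proof. by move=> ij; apply: (@dfwith_out {classic I}); apply/eqP. Qed.

Lemma lcsum_in_linear i : linear (@lcsum_in K I E i).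
Proof.
move=> a x y; apply: lcsumP => j; rewrite linearP/=.
have [<-|ij] := pselect (i = j); first by rewrite !lcsum_in_id.
by rewrite !lcsum_in_neq// scaler0 addr0.
Qed.
HB.instance Definition _ i := GRing.isLinear.Build K (E i) (lcsum E) _
  (@lcsum_in K I E i) (@lcsum_in_linear i).

(** Induction on a list enumerating the support: removing the coordinate at its head leaves a vector
    supported in the tail. *)
Lemma lcsum_ind_support (A : set I) (P : lcsum E -> Prop) : P 0 ->
  (forall i (x : E i) f, A i -> P f -> P (lcsum_in x + f)) ->
  forall f, (forall i, lcsum_coord i f != 0 -> A i) -> P f.
Proof.
move=> P0 PD f.
have /finite_seqP[s fs] :
    finite_set ([set i | lcsum_coord i f != 0] : set {classic I}).
  exact: lcsum_finite.
have {fs} : forall i, lcsum_coord i f != 0 -> i \in s.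
  by move=> i fi; have : [set` s] i by rewrite -fs.
elim: s f => [|i s IH] f fs fA.
  suff -> : f = 0 by [].
  apply: lcsumP => i; rewrite linear0.
  by apply: contrapT => /eqP /fs.
have [fi0|fi] := eqVneq (lcsum_coord i f) 0.
  apply: IH => // j fj; have := fs j fj.
  by case/predU1P => // ji; rewrite ji fi0 eqxx in fj.
have off j : lcsum_coord j (f - lcsum_in (lcsum_coord i f)) != 0 ->
    j <> i /\ lcsum_coord j f != 0.
  rewrite linearB/=; have [->|ij] := pselect (j = i).
    by rewrite lcsum_in_id subrr eqxx.
  by rewrite lcsum_in_neq ?subr0// => /esym.
rewrite -(subrKC (lcsum_in (lcsum_coord i f)) f).
apply: PD; first exact: fA.
apply: IH => j /off[ji fj]; last exact: fA.
by have := fs j fj; case/predU1P.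
Qed.

Lemma lcsum_ind (P : lcsum E -> Prop) : P 0 ->
  (forall i (x : E i) f, P f -> P (lcsum_in x + f)) -> forall f, P f.
Proof.
move=> P0 PD f; apply: (@lcsum_ind_support setT) => // i x g _.
exact: PD.
Qed.

Lemma eq_lcsum_linear (G : lmodType K) (f g : {linear lcsum E -> G}) :
  (forall i (x : E i), f (lcsum_in x) = g (lcsum_in x)) -> f =1 g.
Proof.
move=> fg; elim/lcsum_ind => [|i x h fgh]; first by rewrite !linear0.
by rewrite !linearD fg fgh.
Qed.

Section lift.
Variables (G : lmodType K) (phi : forall i, {linear E i -> G}).

(** The map that the universal property of the direct sum assigns to the family [phi]. *)
Definition lcsum_lift f : G :=
  \sum_(i \in ([set i | lcsum_coord i f != 0] : set {classic I}))
    phi i (lcsum_coord i f).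

Lemma lcsum_lift_widen (D : set {classic I}) f :
  [set i | lcsum_coord i f != 0] `<=` D ->
  lcsum_lift f = \sum_(i \in D) phi i (lcsum_coord i f).
Proof.
move=> fD; apply: fsbig_widen => // i [_ /= /negP].
by rewrite negbK => /eqP ->; rewrite linear0.
Qed.

Lemma lcsum_lift_linear : linear lcsum_lift.
Proof.
move=> a f g.
pose D : set {classic I} :=
  [set i | lcsum_coord i f != 0] `|` [set i | lcsum_coord i g != 0].
have Dfin : finite_set D by rewrite finite_setU; split; exact: lcsum_finite.
rewrite !(@lcsum_lift_widen D); [|by move=> i; right|by move=> i; left|].
  rewrite !fsbig_finite// scaler_sumr -big_split/=; apply: eq_bigr => i _.
  by rewrite !linearP.
move=> i /=; rewrite linearP/= => h.
have [fi|] := eqVneq (lcsum_coord i f) 0; last by left.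
by right; move: h; rewrite fi scaler0 add0r.
Qed.
HB.instance Definition _ := GRing.isLinear.Build K (lcsum E) G _
  lcsum_lift lcsum_lift_linear.

Lemma lcsum_lift_in i (x : E i) : lcsum_lift (lcsum_in x) = phi i x.
Proof.
rewrite (@lcsum_lift_widen [set i]) ?fsbig_set1 ?lcsum_in_id//.
move=> j /=; apply: contra_neqP => ij.
by rewrite lcsum_in_neq// => /esym.
Qed.

End lift.

(** Continuity on the summands makes the initial topology of [f] admissible, so the direct sum
    topology is finer than it. *)
Lemma lcsum_continuous (G : tvsType K) (f : {linear lcsum E -> G}) :
  (forall i, continuous (fun x : E i => f (lcsum_in x))) -> continuous f.
Proof.
move=> fin.
have /lcsum_finest idc :
    @lcsum_admissible K I E (Topological.class (initial_topology f)).
  split; first exact: initial_locally_convex.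
  by move=> i; apply: continuous_comp_initial; exact: fin.
move=> x; apply: (@continuous_comp (lcsum E)
  (Topological.Pack (Topological.class (initial_topology f))) G id f).
  exact: idc.
exact: initial_continuous.
Qed.

Lemma lcsum_lift_continuous (G : tvsType K) (phi : forall i, {linear E i -> G}) :
  (forall i, continuous (phi i)) -> continuous (lcsum_lift phi).
Proof.
move=> phic; apply: (@lcsum_continuous G (lcsum_lift phi)) => i.
rewrite (_ : (fun x => _) = phi i); first exact: phic.
by apply/funext => x; exact: lcsum_lift_in.
Qed.

Definition lcsum_scale (c : I -> K) : lcsum E -> lcsum E :=
  lcsum_lift (fun i => @lcsum_in K I E i \o *:%R (c i)).

HB.instance Definition _ c := GRing.Linear.on (lcsum_scale c).

Lemma lcsum_scale_in c i (x : E i) :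
  lcsum_scale c (lcsum_in x) = c i *: lcsum_in x.
Proof. by rewrite /lcsum_scale lcsum_lift_in /= linearZ. Qed.

Lemma lcsum_scale_coord c f i :
  lcsum_coord i (lcsum_scale c f) = c i *: lcsum_coord i f.
Proof.
pose g : {linear lcsum E -> E i} := lcsum_coord i \o lcsum_scale c.
pose h : {linear lcsum E -> E i} := *:%R (c i) \o lcsum_coord i.
apply: (@eq_lcsum_linear _ g h) => j x.
rewrite -[LHS]/(lcsum_coord i (lcsum_scale c (lcsum_in x))).
rewrite -[RHS]/(c i *: lcsum_coord i (lcsum_in x)) lcsum_scale_in lcsum_coordZ.
have [ji|ij] := pselect (j = i); first by case: _ / ji.
by rewrite !lcsum_in_neq// !scaler0.
Qed.

(** On each summand the map is multiplication by one scalar, so continuity holds even when [c] is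
    unbounded. *)
Lemma lcsum_scale_continuous c : continuous (lcsum_scale c).
Proof.
apply: lcsum_lift_continuous => i x.
apply: continuous_comp; last exact: lcsum_in_continuous.
apply: (@continuous_comp (E i) (K^o * E i)%type (E i)
  (fun x => (c i, x)) (fun z => z.1 *: z.2)); last exact: scale_continuous.
by apply: (@cvg_pair _ _ _ _ (nbhs (c i : K^o))); [exact: cvg_cst|exact: cvg_id].
Qed.

End lcsum_theory.

(** * Inclusion of, and restriction to, the subsum over a subset of indices *)

Section restriction.
Variables (K : numFieldType) (I : Type) (E : I -> tvsType K) (A : set I).
Let EA (i : A) := E (val i).

Definition lcsum_incl : lcsum EA -> lcsum E :=
  lcsum_lift (fun i : A =>
    @lcsum_in K I E (val i) : {linear E (val i) -> lcsum E}).

HB.instance Definition _ := GRing.Linear.on lcsum_incl.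

Lemma lcsum_incl_in (i : A) (x : E (val i)) :
  lcsum_incl (@lcsum_in K A EA i x) = lcsum_in x.
Proof. exact: lcsum_lift_in. Qed.

Lemma lcsum_incl_continuous : continuous lcsum_incl.
Proof.
apply: lcsum_lift_continuous => i x.
exact: (@lcsum_in_continuous K I E (val i) x).
Qed.

Lemma lcsum_restr_subproof (f : lcsum E) :
  ((fun i : A => lcsum_val f (val i)) : dprod (fun i => EA i : lmodType K))
    \in @Defs.finite_support K A (fun i => EA i : lmodType K).
Proof.
rewrite unfold_in; apply/asboolP.
apply: (@finite_preimage A I [set i | lcsum_coord i f != 0] val).
  by move=> i j _ _; exact: val_inj.
exact: lcsum_finite.
Qed.

Definition lcsum_restr (f : lcsum E) : lcsum EA := Lcsum (lcsum_restr_subproof f).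

Lemma lcsum_restr_coord (i : A) f :
  lcsum_coord i (lcsum_restr f) = lcsum_coord (val i) f.
Proof. by []. Qed.

Lemma lcsum_restr_linear : linear lcsum_restr.
Proof.
by move=> a f g; apply: lcsumP => i; rewrite linearP !lcsum_restr_coord linearP.
Qed.
HB.instance Definition _ := GRing.isLinear.Build K (lcsum E) (lcsum EA) _
  lcsum_restr lcsum_restr_linear.

Lemma lcsum_restr_in (i : A) (x : E (val i)) :
  lcsum_restr (lcsum_in x) = @lcsum_in K A EA i x.
Proof.
apply: lcsumP => j; rewrite lcsum_restr_coord.
have [ij|ij] := pselect (i = j); first by case: _ / ij; rewrite !lcsum_in_id.
by rewrite !lcsum_in_neq// => /val_inj.
Qed.

Lemma lcsum_restr_in0 i (x : E i) : ~ A i -> lcsum_restr (lcsum_in x) = 0.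
Proof.
move=> Ai; apply: lcsumP => j; rewrite lcsum_restr_coord linear0 lcsum_in_neq//.
by move=> ij; apply: Ai; rewrite ij; exact: set_valP.
Qed.

(** On each summand the map is either a canonical inclusion or zero. *)
Lemma lcsum_restr_continuous : continuous lcsum_restr.
Proof.
apply: (@lcsum_continuous _ _ _ _ lcsum_restr) => i.
have [Ai|Ai] := pselect (A i); last first.
  rewrite (_ : (fun x => _) = cst 0); first exact: cst_continuous.
  by apply/funext => x; exact: lcsum_restr_in0.
rewrite (_ : (fun x => _) = @lcsum_in K A EA (SigSub (mem_set Ai))).
  exact: (@lcsum_in_continuous K A EA (SigSub (mem_set Ai))).
by apply/funext => x; rewrite -lcsum_restr_in.
Qed.

Lemma lcsum_inclK : cancel lcsum_incl lcsum_restr.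
Proof.
elim/lcsum_ind => [|i x f IH]; first by rewrite !linear0.
by rewrite !linearD/= IH lcsum_incl_in lcsum_restr_in.
Qed.

Lemma lcsum_restrK f : (forall i, lcsum_coord i f != 0 -> A i) ->
  lcsum_incl (lcsum_restr f) = f.
Proof.
move: f; apply: (@lcsum_ind_support _ _ _ A) => [|i x f Ai IH].
  by rewrite !linear0.
rewrite !linearD/= IH; congr (_ + _).
by rewrite (@lcsum_restr_in (SigSub (mem_set Ai))) lcsum_incl_in.
Qed.

End restriction.

(** * Finiteness of supports *)

(** Later arguments use [real_or_complex] only through this property, which treats both scalar
    fields at once. *)
Lemma real_or_complex_archimedean (K : numFieldType) : real_or_complex K ->
  forall x : K, exists n : nat, `|x| < n%:R.
Proof.
case=> R x; first by exists (Num.bound `|x|); exact: archi_boundP.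
rewrite normc_def; set r := Num.sqrt _; exists (Num.bound r).
rewrite -(rmorph_nat (real_complex R)) ltcR.
by apply: archi_boundP; exact: sqrtr_ge0.
Qed.

Lemma infinite_set_sequence (T : Type) (A : set T) : infinite_set A ->
  exists2 h : nat -> T, injective h & forall n, A (h n).
Proof.
elim/Ppointed: T => T in A *.
  by move=> /infinite_setN0[x _]; have : @setT T x by []; rewrite emptyE.
move=> /infiniteP/pcard_leP[h]; exists h; last by move=> n; exact: funS.
by apply: in2TT; exact: inj.
Qed.

Section l1_norm.
Variables (K : numFieldType) (I : Type) (B : I -> normedModType K).

(** An alias of the same module, so that it can carry the topology of the l1-norm beside the direct
    sum topology. *)
Definition l1sum : Type := lcsum (fun i => B i : tvsType K).

HB.instance Definition _ :=
  GRing.Lmodule.copy l1sum (lcsum (fun i => B i : tvsType K)).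

Definition l1norm (f : l1sum) : K :=
  \sum_(i \in ([set i | lcsum_coord i f != 0] : set {classic I}))
    `|lcsum_coord i f|.

Lemma l1norm_widen (D : set {classic I}) (f : l1sum) :
  [set i | lcsum_coord i f != 0] `<=` D ->
  l1norm f = \sum_(i \in D) `|lcsum_coord i f|.
Proof.
move=> fD; apply: fsbig_widen => // i [_ /= /negP].
by rewrite negbK => /eqP ->; rewrite normr0.
Qed.

Lemma ler_l1normD (f g : l1sum) : l1norm (f + g) <= l1norm f + l1norm g.
Proof.
pose D : set {classic I} :=
  [set i | lcsum_coord i f != 0] `|` [set i | lcsum_coord i g != 0].
have Dfin : finite_set D by rewrite finite_setU; split; exact: lcsum_finite.
rewrite !(@l1norm_widen D); [|by move=> i; right|by move=> i; left|].
  rewrite !fsbig_finite// -big_split/=; apply: ler_sum => i _.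
  by rewrite linearD; exact: ler_normD.
move=> i /=; rewrite linearD/= => h.
have [fi|] := eqVneq (lcsum_coord i f) 0; last by left.
by right; move: h; rewrite fi add0r.
Qed.

Lemma l1normZ (a : K) (f : l1sum) : l1norm (a *: f) = `|a| * l1norm f.
Proof.
have Dfin : finite_set ([set i | lcsum_coord i f != 0] : set {classic I}).
  exact: lcsum_finite.
rewrite (@l1norm_widen [set i | lcsum_coord i f != 0]).
  rewrite /l1norm !fsbig_finite// mulr_sumr; apply: eq_bigr => i _.
  by rewrite linearZ; exact: normrZ.
by move=> i /=; apply: contra_neq => fi; rewrite linearZ/= fi scaler0.
Qed.

Lemma le_coord_l1norm (f : l1sum) i : `|lcsum_coord i f| <= l1norm f.
Proof.
have [->|fi] := eqVneq (lcsum_coord i f) 0.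
  by rewrite normr0 /l1norm; apply: fsumr_ge0 => j _.
have Dfin : finite_set ([set i | lcsum_coord i f != 0] : set {classic I}).
  exact: lcsum_finite.
rewrite /l1norm fsbig_finite// (big_fsetD1 (i : {classic I}))/=.
  by rewrite lerDl sumr_ge0.
by rewrite in_fset_set// inE.
Qed.

Lemma l1norm0_eq0 (f : l1sum) : l1norm f = 0 -> f = 0.
Proof.
move=> f0; apply: lcsumP => i; rewrite linear0.
by apply/eqP; rewrite -normr_le0 -f0; exact: le_coord_l1norm.
Qed.

HB.instance Definition _ := Lmodule_isNormed.Build K l1sum
  ler_l1normD l1normZ l1norm0_eq0.

Lemma l1norm_in i (x : B i) :
  l1norm (@lcsum_in K I (fun i => B i : tvsType K) i x) = `|x|.
Proof.
rewrite (@l1norm_widen [set i]) ?fsbig_set1 ?lcsum_in_id//.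
move=> j /=; apply: contra_neqP => ij.
by rewrite lcsum_in_neq// => /esym.
Qed.

(** By [l1norm_in] the identity is isometric on each summand, hence continuous there. *)
Lemma l1norm_id_continuous :
  continuous (id : lcsum (fun i => B i : tvsType K) -> l1sum).
Proof.
pose idl : {linear lcsum (fun i => B i : tvsType K) -> l1sum} := idfun.
apply: (@lcsum_continuous _ _ _ (l1sum : tvsType K) idl) => i.
pose g := @lcsum_in K I (fun i => B i : tvsType K) i : B i -> l1sum.
have gl : linear g by exact: lcsum_in_linear.
pose f : {linear B i -> l1sum} :=
  HB.pack g (GRing.isLinear.Build K (B i) l1sum _ g gl).
apply: (@bounded_linear_continuous _ _ _ f).
apply/bounded_funP => r; exists r => x xr.
by rewrite (_ : `|f x| = `|x|)//; exact: l1norm_in.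
Qed.

(* If infinitely many coordinates of [A] were nonzero, rescaling the [n]-th of
   them so that it is at least [n |x|] at some [x] would leave [A] continuous
   but make it unbounded for the l1-norm. *)
Lemma lcsum_range_finite_support (V : normedModType K)
    (A : {linear V -> lcsum (fun i => B i : tvsType K)}) :
  (forall x : K, exists n : nat, `|x| < n%:R) -> continuous A ->
  finite_set [set i | exists x, lcsum_coord i (A x) != 0].
Proof.
move=> archiK Ac; set D := [set i | _]; apply: contrapT.
move=> /infinite_set_sequence[h hinj hD].
have /choice[x xP] : forall n, exists x, lcsum_coord (h n) (A x) != 0.
  by move=> n; exact: hD.
(* The factor at [h n] is solved for so that the estimate becomes an equality; injectivity of [h]
   makes it well defined. Off the range of [h] the value 0 is a default. *)
have /choice[c cP] i : exists c : K, forall n, h n = i ->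
    n%:R * `|x n| <= `|c| * `|lcsum_coord i (A (x n))|.
  have [[n <-]|nh] := pselect (exists n, h n = i); last first.
    by exists 0 => n hn; exfalso; apply: nh; exists n.
  exists (n%:R * `|x n| / `|lcsum_coord (h n) (A (x n))|) => m hmn.
  have -> : m = n by exact: hinj.
  by rewrite ger0_norm ?divr_ge0 ?mulr_ge0// divfK ?normr_eq0 ?xP.
pose f : {linear lcsum (fun i => B i : tvsType K) ->
                  lcsum (fun i => B i : tvsType K)} := lcsum_scale c.
have fc : continuous f by exact: lcsum_scale_continuous.
pose F : {linear V -> l1sum} :=
  (idfun : {linear lcsum (fun i => B i : tvsType K) -> l1sum}) \o (f \o A).
have Fc : continuous F.
  move=> v; apply: continuous_comp; last exact: l1norm_id_continuous.
  by apply: continuous_comp; [exact: Ac|exact: fc].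
(* With [r] a bound for [F] and [n] greater than [r], evaluation at [x n] gives
   [n * |x n| <= r * |x n|], which is absurd as [x n] is nonzero. *)
have /linear_boundedP/pinfty_ex_gt0[r r0 Fr] :=
  continuous_linear_bounded 0 (Fc 0).
have [n rn] := archiK r.
have xn0 : x n != 0.
  by apply/eqP => xn0; have := xP n; rewrite xn0 !linear0 eqxx.
have fE : `|lcsum_coord (h n) (f (A (x n)))| =
    `|c (h n)| * `|lcsum_coord (h n) (A (x n))|.
  rewrite -normrZ; congr `|_|.
  exact: (@lcsum_scale_coord K I (fun i => B i : tvsType K)).
have := cP (h n) n erefl; rewrite -fE => /le_trans/(_ (le_coord_l1norm _ _)).
move=> /le_trans/(_ (Fr (x n))); rewrite ler_pM2r ?normr_gt0//.
by move=> /(lt_le_trans rn); rewrite gtr0_norm// ltxx.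
Qed.

End l1_norm.

(** * Well-ordered rankings with countable fibres *)

(** The order axioms are read off from least elements of sets with at most three points. *)
Lemma exists_well_order (T : Type) : exists R : rel T,
  [/\ transitive R, antisymmetric R, total R &
      forall A : set T, A !=set0 -> exists2 z, A z & forall x, A x -> R z x].
Proof.
have [R Rwo] := wochoice.well_ordering_principle {classic T}; exists R.
have minR (A : set T) : A !=set0 -> exists2 z, A z & forall x, A x -> R z x.
  move=> [a Aa]; have [|z [[zA zmin] _]] := Rwo [pred x | `[< A x >]].
    by exists a; apply/asboolP.
  exists z; first by move/asboolP: zA.
  by move=> x Ax; apply: zmin; apply/asboolP.
(* If [R x y] and [R y x], both points are least in the pair, and least elements are unique. *)
have anti : antisymmetric R.
  move=> x y /andP[xy yx].
  have [|z [_ zuniq]] := Rwo [pred t | `[< [set x; y] t >]].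
    by exists x; apply/asboolP; left.
  have min t : [set x; y] t -> R t x && R t y -> t = z.
    move=> txy /andP[tx ty]; apply/esym/zuniq; split.
      by apply/asboolP.
    by move=> _ /asboolP[->|->].
  have refl t : R t t.
    have [|u ut] := minR [set t]; first by exists t.
    by rewrite ut => /(_ t erefl).
  by rewrite (min x) ?refl ?xy//; [rewrite (min y)// ?refl ?yx//; right|left].
split=> // [y x z xy yz|x y].
- have [|t txyz tmin] := minR [set x; y; z]; first by exists x; left; left.
  have [tx ty tz] : [/\ R t x, R t y & R t z].
    by split; apply: tmin; [left; left|left; right|right].
  case: txyz => [[|]|] te; rewrite te in tx ty tz => //.
    by rewrite (anti x y) ?xy.
  by rewrite (anti y z) ?yz in xy.
- have [|t txy tmin] := minR [set x; y]; first by exists x; left.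
  case: txy => te; apply/orP; [left|right]; rewrite -{1}te; apply: tmin.
    by right.
  by left.
Qed.

Section closure.
Variables (T : Type) (S : T -> set T).

Definition iter_closure (s : T) (n : nat) : set T :=
  iter n (fun A => \bigcup_(t in A) S t) [set s].

(** The points reachable from [s] by finitely many steps along [S]. *)
Definition set_closure (s : T) : set T := \bigcup_n iter_closure s n.

Lemma set_closure_refl s : set_closure s s.
Proof. by exists 0%N. Qed.

Lemma set_closure_step s t u : set_closure s t -> S t u -> set_closure s u.
Proof. by move=> [n _ st] tu; exists n.+1 => //; exists t. Qed.

Lemma countable_set_closure s : (forall t, countable (S t)) ->
  countable (set_closure s).
Proof.
move=> Sc; apply: bigcup_countable => // n _; elim: n => [|n IH] /=.
  exact: countable1.
by apply: bigcup_countable.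
Qed.

End closure.

(** Take for [rho t] the least [s] whose closure contains [t]. The fibre over [s] then lies in the
    countable closure of [s], and a step from [t] to [u] stays in the closure of [rho t], so the
    rank cannot increase. [~~ R y x] is the strict order. *)
Lemma exists_countable_ranking (T : Type) (S : T -> set T) :
  (forall t, countable (S t)) ->
  exists (R : rel T) (rho : T -> T),
    [/\ [/\ reflexive R, antisymmetric R & transitive R],
        well_founded (fun x y => ~~ R y x),
        (forall s, countable [set t | rho t = s]) &
        forall t u, S t u -> R (rho u) (rho t)].
Proof.
move=> Sc; have [R [Rtrans Ranti Rtotal Rmin]] := exists_well_order T.
have /choice[rho rhoP] t : exists r, set_closure S r t /\
    forall s, set_closure S s t -> R r s.
  have [|r rt rmin] := Rmin [set s | set_closure S s t].
    by exists t; exact: set_closure_refl.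
  by exists r.
exists R, rho; split.
- by split=> [x||]; [have := Rtotal x x; rewrite orbb|exact: Ranti|exact: Rtrans].
(* A least inaccessible element would have only accessible predecessors. *)
- move=> x; apply: contrapT => nx.
  have [|z nz zmin] := Rmin [set y | ~ Acc (fun x y => ~~ R y x) y].
    by exists x.
  apply: nz; constructor => y zy; apply: contrapT => ny.
  by move: zy; rewrite zmin.
- move=> s; apply: sub_countable (countable_set_closure s Sc).
  by apply: subset_card_le => t <-; have [] := rhoP t.
- move=> t u tu; have [rt _] := rhoP t; have [_ umin] := rhoP u.
  by apply: umin; exact: set_closure_step tu.
Qed.

(** * Block matrices *)

Section unipotent.
Variables (K : numFieldType) (I : Type) (E : I -> tvsType K).
Variable M : {linear lcsum E -> lcsum E}.

(** The partial Neumann sum [f + M f + ... + M^(n-1) f], in Horner form. *)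
Fixpoint geometric_sum n (f : lcsum E) : lcsum E :=
  if n is m.+1 then f + M (geometric_sum m f) else 0.

Lemma geometric_sum_linear n : linear (geometric_sum n).
Proof.
elim: n => [|n IH] a f g /=; first by rewrite scaler0 addr0.
by rewrite IH linearP scalerDr addrACA.
Qed.
HB.instance Definition _ n := GRing.isLinear.Build K (lcsum E) (lcsum E) _
  (geometric_sum n) (@geometric_sum_linear n).

Lemma geometric_sum_continuous n : continuous M -> continuous (geometric_sum n).
Proof.
move=> Mc; elim: n => [|n IH]; first exact: (@cst_continuous _ _ 0).
apply: (@continuous_tvsD K (lcsum E) (lcsum E) id (M \o geometric_sum n)).
  by move=> x; exact: cvg_id.
by move=> x; apply: continuous_comp; [exact: IH|exact: Mc].
Qed.

Lemma geometric_sumE n f :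
  geometric_sum n f - M (geometric_sum n f) = f - iter n M f.
Proof.
elim: n => [|n IH]; first by rewrite /= linear0 subr0 subrr.
have -> : geometric_sum n.+1 f = f + M (geometric_sum n f) by [].
rewrite -addrA -linearB opprD (addrC (- f)) addrA IH addrAC subrr add0r.
by rewrite linearN.
Qed.

Lemma iter_linearD n : {morph iter n M : f g / f + g}.
Proof. by elim: n => // n IH f g /=; rewrite IH linearD. Qed.

Lemma iter_linear0 n : iter n M 0 = 0.
Proof. by elim: n => //= n ->; rewrite linear0. Qed.

Lemma iter_eq0_leq m n f : (m <= n)%N -> iter m M f = 0 -> iter n M f = 0.
Proof. by move=> /subnK <- f0; rewrite iterD f0 iter_linear0. Qed.

(** On each summand the Neumann series of [1 - M] terminates, after a number of terms that depends
    on the summand; [lcsum_lift] glues these finite sums into a continuous map. *)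
Lemma unipotent_inverse : continuous M ->
  (forall i, exists n, forall x : E i, iter n M (lcsum_in x) = 0) ->
  exists v : {linear lcsum E -> lcsum E},
    [/\ continuous v, forall f, v f - M (v f) = f & forall f, v (f - M f) = f].
Proof.
move=> Mc /choice[n nP].
pose phi i : {linear E i -> lcsum E} :=
  geometric_sum (n i) \o @lcsum_in K I E i.
pose v : {linear lcsum E -> lcsum E} := lcsum_lift phi.
have vK f : v f - M (v f) = f.
  pose p : {linear lcsum E -> lcsum E} := v \- (M \o v).
  apply: (@eq_lcsum_linear _ _ _ _ p idfun) => i x.
  by rewrite /p /= lcsum_lift_in /= geometric_sumE nP subr0.
exists v; split=> // [|f].
  apply: lcsum_lift_continuous => i x; apply: continuous_comp.
    exact: lcsum_in_continuous.
  exact: geometric_sum_continuous.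
(* For the left inverse: the defect [v (f - M f) - f] is killed by a power of [M], as is every
   finite sum of vectors from summands, while [fixM] shows that [M] fixes it. Hence it is zero. *)
have [m fm] : exists m, iter m M (v (f - M f) - f) = 0.
  elim/lcsum_ind: (_ - f) => [|i x g [m gm]]; first by exists 0%N.
  exists (maxn m (n i)); rewrite iter_linearD.
  rewrite (iter_eq0_leq _ (nP i x)) ?leq_maxr// add0r.
  by rewrite (iter_eq0_leq _ gm) ?leq_maxl.
apply/eqP; rewrite -subr_eq0 -fm eq_sym; apply/eqP.
have fixM : M (v (f - M f) - f) = v (f - M f) - f.
  have /eqP := vK (f - M f); rewrite subr_eq => /eqP vE.
  rewrite [LHS]linearB.
  by rewrite [in RHS]vE addrAC (addrAC f) subrr add0r addrC.
by elim: m {fm} => //= m ->.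
Qed.

End unipotent.

Section banded.
Variables (K : numFieldType) (I : Type) (E : I -> tvsType K).
Implicit Types (f g : {linear lcsum E -> lcsum E}) (A B : I -> I -> Prop).

(* The blocks of the matrix of [f] vanish outside of [A]. *)
Definition banded A f : Prop := forall k (x : E k) i,
  lcsum_coord i (f (lcsum_in x)) != 0 -> A i k.

Lemma banded_sub A B f :
  (forall i k, A i k -> B i k) -> banded A f -> banded B f.
Proof. by move=> AB fA k x i /fA /AB. Qed.

Lemma bandedB A f g : banded A f -> banded A g -> banded A (f \- g).
Proof.
move=> fA gA k x i /=; rewrite linearB/=.
have [->|/fA //] := eqVneq (lcsum_coord i (f (lcsum_in x))) 0.
by rewrite sub0r oppr_eq0 => /gA.
Qed.

(** A nonzero entry of the product needs an intermediate index [j] with nonzero entries in both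
    factors. *)
Lemma banded_comp A B f g : banded A f -> banded B g ->
  banded (fun i k => exists2 j, A i j & B j k) (f \o g).
Proof.
move=> fA gB k x i; pose D j := B j k.
apply: (@lcsum_ind_support _ _ _ D (fun h => lcsum_coord i (f h) != 0 -> _)).
- by rewrite !linear0 eqxx.
- move=> j y h Dj IH; rewrite !linearD/=.
  have [->|/fA Aij _] := eqVneq (lcsum_coord i (f (lcsum_in y))) 0.
    by rewrite add0r.
  by exists j.
- by move=> j /gB.
Qed.

End banded.

(** Well-founded induction on the rank of [k]: by [lcsum_range_finite_support], [M] sends the
    summand [k] into finitely many summands of smaller rank, so their exponents have a maximum. *)
Lemma banded_nilpotent (K : numFieldType) (I J : Type)
    (B : I -> normedModType K) (rho : I -> J) (lt : J -> J -> Prop)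
    (M : {linear lcsum (fun i => B i : tvsType K) ->
                 lcsum (fun i => B i : tvsType K)}) :
  (forall x : K, exists n : nat, `|x| < n%:R) -> well_founded lt ->
  continuous M -> banded (fun i k => lt (rho i) (rho k)) M ->
  forall k, exists n, forall x : B k,
    iter n M (@lcsum_in K I (fun i => B i : tvsType K) k x) = 0.
Proof.
move=> archiK wf Mc Mlt k.
have [j kj] : exists j, rho k = j by exists (rho k).
elim/(well_founded_ind wf): j k kj => j IH k kj; rewrite -kj in IH.
pose f : {linear (B k : tvsType K) -> lcsum (fun i => B i : tvsType K)} :=
  M \o @lcsum_in K I (fun i => B i : tvsType K) k.
have /(lcsum_range_finite_support archiK) : continuous f.
  move=> x; apply: continuous_comp; last exact: Mc.
  exact: (@lcsum_in_continuous K I (fun i => B i : tvsType K)).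
set D := [set i | _] => Dfin.
have /choice[n nP] i : exists n, D i -> forall x : B i,
    iter n M (@lcsum_in K I (fun i => B i : tvsType K) i x) = 0.
  have [[y /Mlt ik]|nD] := pselect (D i); last by exists 0%N.
  by have [n nP] := IH _ ik i erefl; exists n.
have /finite_seqP[s Ds] : finite_set (D : set {classic I}) by [].
(* The extra iteration is the first application of [M], which lands in the summands listed in
   [s]. *)
exists (\max_(i <- s) n i).+1 => x; rewrite iterSr.
apply: (@lcsum_ind_support _ _ _ D (fun h => iter _ M h = 0)).
- exact: iter_linear0.
- move=> i y h Di hn; rewrite iter_linearD hn addr0.
  apply: (@iter_eq0_leq _ _ _ _ (n i)); last exact: nP.
  have si : (i : {classic I}) \in s by have : [set` s] i by rewrite -Ds.
  exact: (@leq_bigmax_seq _ _ xpredT (fun i : {classic I} => n i)).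
- by move=> i Mi; exists x.
Qed.

(** * Corestrictions, and subspaces of fixed points *)

Section subspaces.
Variables (K : numFieldType) (V : tvsType K).

Lemma lcsub_val_linear (X : lin_subspace V) : linear (@lcsub_val K V X).
Proof. by move=> a x y; rewrite lcsub_valD lcsub_valZ. Qed.
HB.instance Definition _ (X : lin_subspace V) :=
  GRing.isLinear.Build K (lcsub X) V _ (@lcsub_val K V X)
    (@lcsub_val_linear X).

Section corestriction.
Variables (U : tvsType K) (X : lin_subspace V) (f : {linear U -> V}).
Hypothesis fX : forall u, f u \in X.

Definition lcsub_corestr (u : U) : lcsub X := Lcsub (fX u).

Lemma lcsub_corestr_linear : linear lcsub_corestr.
Proof.
by move=> a u v; apply: val_inj; rewrite [RHS]linearP /= linearP.
Qed.
HB.instance Definition _ := GRing.isLinear.Build K U (lcsub X) _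
  lcsub_corestr lcsub_corestr_linear.

Lemma lcsub_corestr_continuous : continuous f -> continuous lcsub_corestr.
Proof. by move=> fc; apply: continuous_comp_initial. Qed.

End corestriction.

(** For idempotent [q] this is the range of [q], given by an equation. *)
Definition fixed_points (q : {linear V -> V}) : {pred V} := fun x => q x == x.

Lemma fixed_points_submod q : submod_closed (fixed_points q).
Proof.
split=> [|a x y]; rewrite !unfold_in ?linear0// => /eqP qx /eqP qy.
by rewrite linearP qx qy.
Qed.
HB.instance Definition _ q :=
  GRing.isSubmodClosed.Build K V (fixed_points q) (@fixed_points_submod q).

Lemma fixed_pointsP (q : {linear V -> V}) x :
  reflect (q x = x) (x \in fixed_points q).
Proof. exact: eqP. Qed.

End subspaces.

(** * Block projections and the block diagonal of an operator *)

Section block_diagonal.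
Variables (K : numFieldType) (T J : Type) (B : T -> normedModType K).
Local Notation E := (lcsum (fun t => B t : tvsType K)).
Local Notation inj := (@lcsum_in K T (fun t => B t : tvsType K)).
Variable rho : T -> J.

(** The encoding as a diagonal map with entries 0 and 1 yields continuity and coordinates from
    [lcsum_scale]. *)
Definition block_proj (j : J) : E -> E :=
  @lcsum_scale K T (fun t => B t : tvsType K) (fun t => `[< rho t = j >]%:R).
HB.instance Definition _ j := GRing.Linear.on (block_proj j).

Lemma block_proj_continuous j : continuous (block_proj j).
Proof. exact: lcsum_scale_continuous. Qed.

Lemma block_proj_in t (x : B t) : block_proj (rho t) (inj x) = inj x.
Proof. by rewrite /block_proj lcsum_scale_in asboolT// scale1r. Qed.

Lemma block_proj_in0 j t (x : B t) : rho t <> j -> block_proj j (inj x) = 0.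
Proof. by move=> tj; rewrite /block_proj lcsum_scale_in asboolF// scale0r. Qed.

Lemma block_proj_coord t f :
  lcsum_coord t (block_proj (rho t) f) = lcsum_coord t f.
Proof. by rewrite /block_proj lcsum_scale_coord asboolT// scale1r. Qed.

Lemma block_proj_coord0 j t f : rho t <> j ->
  lcsum_coord t (block_proj j f) = 0.
Proof. by move=> tj; rewrite /block_proj lcsum_scale_coord asboolF// scale0r. Qed.

Variable r : {linear E -> E}.

Definition block_diag : E -> E :=
  lcsum_lift (fun t =>
    block_proj (rho t) \o (r \o @lcsum_in K T (fun t => B t : tvsType K) t)
      : {linear (B t : tvsType K) -> E}).
HB.instance Definition _ := GRing.Linear.on block_diag.

Lemma block_diag_in t (x : B t) :
  block_diag (inj x) = block_proj (rho t) (r (inj x)).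
Proof. exact: lcsum_lift_in. Qed.

Lemma block_diag_continuous : continuous r -> continuous block_diag.
Proof.
move=> rc; apply: lcsum_lift_continuous => t x.
apply: continuous_comp; last exact: block_proj_continuous.
apply: continuous_comp; last exact: rc.
exact: (@lcsum_in_continuous K T (fun t => B t : tvsType K)).
Qed.

(** On the summand [t], both sides equal [block_diag] if [t] has rank [j], and both vanish
    otherwise. *)
Lemma block_proj_diag j f :
  block_proj j (block_diag f) = block_diag (block_proj j f).
Proof.
pose g : {linear E -> E} := block_proj j \o block_diag.
pose h : {linear E -> E} := block_diag \o block_proj j.
apply: (@eq_lcsum_linear _ _ _ _ g h) => t x.
rewrite -[LHS]/(block_proj j (block_diag (inj x))).
rewrite -[RHS]/(block_diag (block_proj j (inj x))).
have [<-|tj] := pselect (rho t = j).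
  rewrite block_proj_in block_diag_in; apply: lcsumP => i.
  have [<-|it] := pselect (rho i = rho t); first by rewrite block_proj_coord.
  by rewrite !block_proj_coord0.
rewrite block_proj_in0// linear0 block_diag_in; apply: lcsumP => i.
rewrite linear0; have [ij|ij] := pselect (rho i = j).
  by rewrite -ij block_proj_coord block_proj_coord0// ij => /esym.
by rewrite block_proj_coord0.
Qed.

Lemma block_projK j f : block_proj j (block_proj j f) = block_proj j f.
Proof.
apply: lcsumP => i; have [<-|ij] := pselect (rho i = j).
  by rewrite block_proj_coord.
by rewrite !block_proj_coord0.
Qed.

Lemma banded_block_diag :
  banded (fun i k => rho i = rho k) [the {linear E -> E} of block_diag].
Proof.
move=> k x i; rewrite -[X in lcsum_coord i X]/(block_diag (inj x)) block_diag_in.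
by have [//|ik] := pselect (rho i = rho k); rewrite block_proj_coord0 ?eqxx.
Qed.

End block_diagonal.

(** * Comparison of an idempotent with its block diagonal *)

Section idempotent.
Variables (K : numFieldType) (T J : Type) (B : T -> normedModType K).
Local Notation E := (lcsum (fun t => B t : tvsType K)).
Variables (rho : T -> J) (R : rel J) (r : {linear E -> E}).
Hypothesis archiK : forall x : K, exists n : nat, `|x| < n%:R.
Hypothesis Rrefl : reflexive R.
Hypothesis Ranti : antisymmetric R.
Hypothesis Rtrans : transitive R.
Hypothesis Rwf : well_founded (fun x y => ~~ R y x).
Hypothesis rc : continuous r.
Hypothesis rr : forall f, r (r f) = r f.
Hypothesis Rr : banded (fun i k => R (rho i) (rho k)) r.

Let d : {linear E -> E} := block_diag rho r.
Let n : {linear E -> E} := r \- d.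
Let lt (i k : T) := ~~ R (rho k) (rho i).
Let le (i k : T) : Prop := R (rho i) (rho k).

Let le_lt_comp i j k : le i j -> lt j k -> lt i k.
Proof. by move=> ij; apply: contra => /Rtrans; exact. Qed.

Let lt_le_comp i j k : lt i j -> le j k -> lt i k.
Proof. by move=> + jk; apply: contra; exact: Rtrans. Qed.

Let deq : banded (fun i k => rho i = rho k) d.
Proof. exact: banded_block_diag. Qed.

(** Within a block [r] and [d] cancel; elsewhere [n] agrees with [r], and antisymmetry of [R] makes
    the inequality of ranks strict. *)
Let nlt : banded lt n.
Proof.
move=> k x i; rewrite -[n _]/(r _ - block_diag rho r _) block_diag_in.
have [ik|ik] := pselect (rho i = rho k).
  by rewrite lcsum_coordB -ik block_proj_coord subrr eqxx.
rewrite lcsum_coordB block_proj_coord0// subr0 => /Rr ikR.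
by apply/negP => kiR; apply: ik; apply: Ranti; rewrite ikR.
Qed.

Let nle : banded le n.
Proof.
apply: bandedB => //; apply: banded_sub deq => i k ik.
by rewrite /le ik Rrefl.
Qed.

Let nE f : n f = r f - d f. Proof. by []. Qed.

(* [d d - d] is block diagonal, and strictly triangular because [r r = r]. *)
Lemma block_diag_idempotent f : d (d f) = d f.
Proof.
pose s : {linear E -> E} := (d \o d) \- d.
suff : s f = 0 by move/eqP; rewrite subr_eq0 => /eqP.
(* [s'] is [(n - r n) - (n r - n n)]. Since [n - r n = r d - d] and [n r - n n = n d = r d - d d],
   it equals [s]; each of its terms has the strictly triangular factor [n]. *)
pose s' : {linear E -> E} := (n \- (r \o n)) \- ((n \o r) \- (n \o n)).
have subBB (x y z : E) : x - y - (x - z) = z - y.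
  by rewrite opprB addrC addrA subrK.
have ss' g : s g = s' g.
  have -> : s g = d (d g) - d g by [].
  have -> : s' g = (n g - r (n g)) - (n (r g) - n (n g)) by [].
  rewrite !nE !(linearB r) !(linearB d) !rr subBB.
  move: (r g) (d g) (r (d g)) (d (r g)) (d (d g)) => a b c e h.
  by rewrite (opprB (a - c)) (addrA (a - e)) (addrA (a - e)) subrK !subBB.
have seq : banded (fun i k => rho i = rho k) s.
  apply: bandedB => //; apply: banded_sub (banded_comp deq deq) => i k [j].
  by move=> ->.
have slt : banded lt s'.
  have nnlt : banded lt (n \o n).
    apply: banded_sub (banded_comp nlt nle) => i k [j].
    exact: lt_le_comp.
  apply: bandedB; apply: bandedB => //.
    by apply: banded_sub (banded_comp Rr nlt) => i k [j]; exact: le_lt_comp.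
  by apply: banded_sub (banded_comp nlt Rr) => i k [j]; exact: lt_le_comp.
pose z : {linear E -> E} := \0.
apply: (@eq_lcsum_linear _ _ _ _ s z) => k x; apply: lcsumP => i.
rewrite linear0; apply/eqP/negPn/negP => six.
have := slt k x i; rewrite -ss' => /(_ six).
by rewrite /lt (seq _ _ _ six) Rrefl.
Qed.

(** Here [v] inverts the [u] with [r u = r d = u d]. The two identities say that [d v] and [r] are
    mutually inverse between the ranges of [r] and [d]. *)
Lemma idempotent_block_diag : exists v : {linear E -> E},
  [/\ continuous v, forall f, r (d (v f)) = r f &
      forall f, v (r (d f)) = d f].
Proof.
have ndE f : n (d f) = r (d f) - d f by rewrite nE block_diag_idempotent.
(* Writing [M] as [n - 2 n d] makes strict triangularity visible, as [d] preserves ranks. *)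
pose M : {linear E -> E} := n \- (n \o d) \- (n \o d).
have ME f : M f = n f - n (d f) - n (d f) by [].
have dc : continuous d by exact: block_diag_continuous.
have nc : continuous n by exact: continuous_tvsB.
have ndc : continuous (n \o d).
  by move=> x; apply: continuous_comp; [exact: dc|exact: nc].
have Mc : continuous M.
  by apply: continuous_tvsB => //; exact: continuous_tvsB.
have ndlt : banded lt (n \o d).
  apply: banded_sub (banded_comp nlt deq) => i k [j ij jk].
  by rewrite /lt -jk.
have Mlt : banded lt M by apply: bandedB => //; exact: bandedB.
have [v [vc vK Kv]] :=
  unipotent_inverse Mc (banded_nilpotent archiK Rwf Mc Mlt).
(* [1 - M = r d + (1 - r) (1 - d)] *)
exists v; split=> // f.
  rewrite -[in RHS](vK f); set w := v f.
  rewrite ME !ndE nE !(linearB r) !rr subrr !subr0.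
  by rewrite subKr.
have dM : d f - M (d f) = r (d f).
  by rewrite ME !block_diag_idempotent subrr sub0r opprK ndE subrKC.
by rewrite -dM Kv.
Qed.

End idempotent.

(** * The decomposition *)

Lemma card_eq_nat (T : Type) (A : set T) :
  countable A -> infinite_set A -> (A #= [set: nat])%card.
Proof. by move=> cA /infiniteP iA; rewrite card_eq_le; apply/andP. Qed.

Theorem theorem2p2 (K : numFieldType) (hK : real_or_complex K)
    (T : Type) (hT : ~ countable [set: T])
    (B : T -> completeNormedModType K)
    (X : lin_subspace (lcsum (fun t => B t : tvsType K) : tvsType K))
    (hX : complemented X) :
  exists (J : Type) (S : J -> set T)
    (F : forall j : J,
       lin_subspace (lcsum (fun t : S j => B (val t) : tvsType K) : tvsType K)),
    [/\ forall j, (S j #= [set: nat])%card,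
        forall j, complemented (F j) &
        lc_isomorphic (lcsub X : tvsType K)
          (lcsum (fun j => lcsub (F j) : tvsType K) : tvsType K)].
Proof.
pose Et t : tvsType K := B t.
pose E : tvsType K := lcsum Et.
pose inj t : {linear Et t -> E} := @lcsum_in K T Et t.
have archiK := real_or_complex_archimedean hK.
have Tinf : infinite_set [set: T].
  by move=> /finite_set_countable.
have [h hinj _] := infinite_set_sequence Tinf.
have [r rc rX] := hX.
pose rE : {linear E -> E} := @lcsub_val K E X \o r.
have rEc : continuous rE.
  by move=> x; apply: continuous_comp; [exact: rc|exact: lcsub_val_continuous].
have rErE f : rE (rE f) = rE f by rewrite /rE /= rX.
have Sfin t : countable [set i | exists x, lcsum_coord i (rE (inj t x)) != 0].
  apply: finite_set_countable.
  pose A : {linear Et t -> E} := rE \o inj t.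
  apply: (@lcsum_range_finite_support K T B (B t) A archiK).
  by move=> x; apply: continuous_comp; [exact: lcsum_in_continuous|exact: rEc].
have [R [rho [[Rrefl Ranti Rtrans] Rwf rho_countable rhoR]]] :=
  exists_countable_ranking Sfin.
have rEband : banded (fun i k => R (rho i) (rho k)) rE.
  by move=> k x i rxi; apply: rhoR; exists x.
pose P j : {linear E -> E} := @block_proj K T T B rho j.
pose d : {linear E -> E} := @block_diag K T T B rho rE.
have Pc j : continuous (P j) by exact: block_proj_continuous.
have dc : continuous d by exact: block_diag_continuous.
have dd f : d (d f) = d f.
  exact: (block_diag_idempotent Rrefl Ranti Rtrans rErE rEband).
have Pd j f : P j (d f) = d (P j f) by exact: block_proj_diag.
have PP j f : P j (P j f) = P j f by exact: block_projK.
have [v [vc rdv vrd]] := @idempotent_block_diag K T T B rho R rE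
  archiK Rrefl Ranti Rtrans Rwf rEc rErE rEband.
pose S j : set T := [set t | rho t = j] `|` range h.
have Scard j : (S j #= [set: nat])%card.
  apply: card_eq_nat.
    rewrite /S -bigcup2E; apply: bigcup_countable; first exact: countableP.
    move=> [|[|i]] _ /=; [exact: rho_countable| |exact: countable0].
    by apply: sub_countable (card_image_le _ _) _; exact: countableP.
  apply: (@sub_infinite_set _ (range h)); first by move=> t; right.
  rewrite (eq_finite_set (inj_card_eq (A := setT) (in2W hinj))).
  exact: infinite_nat.
pose ES j : tvsType K := lcsum (fun t : S j => Et (val t)).
pose incl j : {linear ES j -> E} := @lcsum_incl K T Et (S j).
pose restr j : {linear E -> ES j} := @lcsum_restr K T Et (S j).
have inclc j : continuous (incl j) by exact: lcsum_incl_continuous.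
have restrc j : continuous (restr j) by exact: lcsum_restr_continuous.
have inclK j y : restr j (incl j y) = y by exact: lcsum_inclK.
have restrP j f : incl j (restr j (P j f)) = P j f.
  apply: lcsum_restrK => i Pfi; left; apply: contrapT => ij.
  by move: Pfi; rewrite [P j f]/(block_proj _ _ _) block_proj_coord0// eqxx.
(* The block of [d] at [j], seen on the subsum over [S j]; [P j] discards the coordinates from
   [range h] whose rank is not [j]. *)
pose q j : {linear ES j -> ES j} := restr j \o (d \o (P j \o incl j)).
have qE j y : q j y = restr j (d (P j (incl j y))) by [].
have incl_q j y : incl j (q j y) = d (P j (incl j y)).
  by rewrite qE -Pd restrP.
have qc j : continuous (q j).
  move=> y; apply: continuous_comp; last exact: restrc.
  apply: continuous_comp; last exact: dc.
  by apply: continuous_comp; [exact: inclc|exact: Pc].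
have qq j y : q j (q j y) = q j y.
  by rewrite [LHS]qE incl_q Pd PP dd.
pose F j : lin_subspace (ES j) := fixed_points (q j).
have qF j y : q j y \in F j by apply/fixed_pointsP.
pose c j : {linear ES j -> lcsub (F j)} := lcsub_corestr (qF j).
have cc j : continuous (c j) by exact: lcsub_corestr_continuous.
have cK j (y : lcsub (F j)) : c j (lcsub_val y) = y.
  by apply: val_inj; case: y => y yF; exact: (elimT (fixed_pointsP (q j) y) yF).
(* Ranks are elements of [T], so [T] indexes the blocks; an empty fibre contributes a zero space. *)
exists T, S, F; split; first exact: Scard.
  by move=> j; exists (c j); [exact: cc|exact: cK].
pose G j : tvsType K := lcsub (F j).
pose phi j : {linear G j -> lcsub X} :=
  r \o (incl j \o @lcsub_val K (ES j) (F j)).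
pose Phi : {linear lcsum G -> lcsub X} := lcsum_lift phi.
(* [c] applies [q], so [delta] is [d] followed by the splitting into blocks. *)
pose delta_in t : {linear Et t -> lcsum G} :=
  @lcsum_in K T G (rho t) \o (c (rho t) \o (restr (rho t) \o inj t)).
pose delta : {linear E -> lcsum G} := lcsum_lift delta_in.
pose Psi : {linear lcsub X -> lcsum G} := delta \o (v \o @lcsub_val K E X).
have delta_inE t x : delta (inj t x) =
    lcsum_in (c (rho t) (restr (rho t) (inj t x)) : G (rho t)).
  exact: lcsum_lift_in.
have Phi_delta f : Phi (delta f) = r (d f).
  pose a : {linear E -> lcsub X} := Phi \o delta.
  pose b : {linear E -> lcsub X} := r \o d.
  apply: (@eq_lcsum_linear _ _ _ _ a b) => t x.
  rewrite -[LHS]/(Phi (delta (inj t x))) -[RHS]/(r (d (inj t x))).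
  rewrite delta_inE [LHS]lcsum_lift_in.
  rewrite -[LHS]/(r (incl _ (q _ (restr (rho t) (inj t x))))) incl_q.
  have Pin : P (rho t) (inj t x) = inj t x by exact: block_proj_in.
  by rewrite -[in LHS]Pin restrP PP Pin.
(* A vector inside block [j] is sent to the single summand [j]; this evaluates [delta] when [Psi] is
   applied after [Phi]. *)
have delta_P j f :
    delta (P j f) = lcsum_in (c j (restr j (P j f)) : G j).
  pose a : {linear E -> lcsum G} := delta \o P j.
  pose b : {linear E -> lcsum G} :=
    @lcsum_in K T G j \o (c j \o (restr j \o P j)).
  apply: (@eq_lcsum_linear _ _ _ _ a b) => t x.
  rewrite -[LHS]/(delta (P j (inj t x))).
  rewrite -[RHS]/(lcsum_in (c j (restr j (P j (inj t x))) : G j)).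
  have [<-|tj] := pselect (rho t = j).
    have -> : P (rho t) (inj t x) = inj t x by exact: block_proj_in.
    exact: delta_inE.
  have -> : P j (inj t x) = 0 by exact: block_proj_in0.
  by rewrite !linear0.
exists Psi, Phi; split.
- move=> x; apply: val_inj.
  rewrite -[Psi x]/(delta (v (lcsub_val x))) Phi_delta.
  by rewrite -[LHS]/(rE (d (v (lcsub_val x)))) rdv /rE /= rX.
- move=> w; pose a : {linear lcsum G -> lcsum G} := Psi \o Phi.
  apply: (@eq_lcsum_linear _ _ _ _ a idfun) => j y.
  rewrite -[LHS]/(Psi (Phi (lcsum_in y))) [Phi _]lcsum_lift_in.
  (* [e] lies in block [j] and is fixed by [d], so [v (r e) = e] by [vrd], and [delta] returns [y]
     in summand [j]. *)
  set e := incl j (lcsub_val y).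
  rewrite -[LHS]/(delta (v (rE e))).
  have dPe : d (P j e) = e.
    by rewrite -incl_q; congr (incl j _); case: y @e => y /= /fixed_pointsP.
  have de : d e = e by rewrite -dPe dd.
  have Pe : P j e = e by rewrite -dPe Pd PP.
  rewrite -[in LHS]de vrd de -[in LHS]Pe delta_P Pe inclK.
  by congr lcsum_in; exact: cK.
- move=> x; apply: continuous_comp.
    apply: continuous_comp; [exact: lcsub_val_continuous|exact: vc].
  apply: lcsum_lift_continuous => t {}x.
  apply: continuous_comp; last exact: lcsum_in_continuous.
  apply: continuous_comp; last exact: cc.
  by apply: continuous_comp; [exact: lcsum_in_continuous|exact: restrc].
- apply: lcsum_lift_continuous => j y.
  apply: continuous_comp; last exact: rc.
  by apply: continuous_comp; [exact: lcsub_val_continuous|exact: inclc].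
Qed.
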